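(* Let $\mathbf{S}$ be a finite semigroup such that the variety $\mathsf{HSP}(\mathbf{S})$ generated by $\mathbf{S}$ contains a proper $3$-nilpotent semigroup. Then $\mathbf{S}$ is inherently nondualisable.
   Context: A semigroup is $k$-nilpotent if it satisfies the law $x_1x_2\dots x_k\approx y_1y_2\dots y_k$ (equivalently, it has a zero element $0$ and every product of length $k$ equals $0$); it is proper $k$-nilpotent if it is $k$-nilpotent but not $(k-1)$-nilpotent. Semigroups are algebras with a single binary operation. Duality notions. Let $\mathbf{M}$ be a finite algebra and $\mathcal{Q}=\mathsf{ISP}(\mathbf{M})$ the quasivariety it generates (isomorphic copies of subalgebras of direct powers of $\mathbf{M}$). An alter ego $\mathbb{M}$ of $\mathbf{M}$ is a structure on the same universe $M$, carrying the discrete topology and some finitary operations, partial operations and relations, such that each $n$-ary operation is a homomorphism $\mathbf{M}^n\to\mathbf{M}$, each $n$-ary relation is a subalgebra of $\mathbf{M}^n$, and each $n$-ary partial operation is a homomorphism from a subalgebra of $\mathbf{M}^n$ into $\mathbf{M}$. Let $\mathcal{X}=\mathsf{IS_cP^+}(\mathbb{M})$ be the class of topologically and algebraically isomorphic copies of closed substructures of powers of $\mathbb{M}$ over nonempty index sets (product topology, pointwise structure). For $\mathbf{A}\in\mathcal{Q}$, $D(\mathbf{A})=\hom(\mathbf{A},\mathbf{M})$, a closed substructure of $\mathbb{M}^A$; for $\mathbb{A}\in\mathcal{X}$, $E(\mathbb{A})$ is the algebra of continuous homomorphisms (structure-preserving maps) $\mathbb{A}\to\mathbb{M}$, a subalgebra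 of $\mathbf{M}^{\mathbb{A}}$. $\mathbb{M}$ yields a duality on $\mathbf{A}$ if the (always injective) evaluation homomorphism $e:\mathbf{A}\to E(D(\mathbf{A}))$, $e_a(x)=x(a)$, is an isomorphism. $\mathbf{M}$ is dualisable (admits a natural duality) if some alter ego of $\mathbf{M}$ yields a duality on every $\mathbf{A}\in\mathcal{Q}$; otherwise it is nondualisable. A finite algebra $\mathbf{M}$ is inherently nondualisable if $\mathbf{M}\notin\mathsf{ISP}(\mathbf{N})$ for every finite dualisable algebra $\mathbf{N}$. *)

(* Defs.v *)
From HB Require Import structures.
From mathcomp Require Import all_boot.
From mathcomp Require Import all_classical topology.

Set Implicit Arguments.
Unset Strict Implicit.
Unset Printing Implicit Defensive.

Local Open Scope classical_set_scope.
Local Open Scope group_scope.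

(* An algebra of the same type as a semigroup is a magma, so the notions below *)
(* are stated for magmas. Algebras are nonempty, as is usual in the theory of  *)
(* natural dualities.                                                          *)

Definition power (I M : Type) : Type := I -> M.

HB.instance Definition _ (I : Type) (M : choiceType) :=
  Choice.copy (power I M) (I -> M).

Definition power_mul I (M : magmaType) (x y : power I M) : power I M :=
  fun i => x i * y i.

HB.instance Definition _ I (M : magmaType) :=
  hasMul.Build (power I M) (@power_mul I M).

(* the product topology of the discrete topology on M *)
HB.instance Definition _ (I : Type) (M : choiceType) :=
  Topological.copy (power I M) {ptws I -> discrete_topology M}.

Definition subalgebra (A : magmaType) (B : set A) : Prop :=
  B !=set0 /\ forall x y, B x -> B y -> B (x * y).

Definition iso_onto (A B : magmaType) (C : set B) (f : A -> B) : Prop :=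
  {morph f : x y / x * y} /\ set_bij [set: A] C f.

Definition ISP (M A : magmaType) : Prop :=
  exists (I : Type) (B : set (power I M)) (f : A -> power I M),
    subalgebra B /\ iso_onto B f.

(* Only the restriction of g to B matters: it is a homomorphism from B onto A. *)
Definition HSP (M A : magmaType) : Prop :=
  exists (I : Type) (B : set (power I M)) (g : power I M -> A),
    [/\ subalgebra B,
        {in B &, {morph g : x y / x * y}}
      & set_surj B [set: A] g].

(* x_1 x_2 ... x_k, for a nonempty sequence x_1 :: [:: x_2; ...; x_k] *)
Definition sgprod (T : magmaType) (x : T) (s : seq T) : T := foldl mul x s.

(* meaningful for k > 0 only *)
Definition nilpotent (k : nat) (T : semigroupType) : Prop :=
  forall (x y : T) (s t : seq T), (size s).+1 = k -> (size t).+1 = k ->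
    sgprod x s = sgprod y t.

Definition proper_nilpotent (k : nat) (T : semigroupType) : Prop :=
  nilpotent k T /\ ~ nilpotent k.-1 T.

(* A partial operation is an option-valued function, with domain the set of    *)
(* tuples which it does not map to None.                                       *)
Definition pdom (T U : Type) (h : T -> option U) : set T := [set x | h x].

Record alter_ego (M : magmaType) := AlterEgo {
  ae_op : forall n, set (power 'I_n M -> M);
  ae_pop : forall n, set (power 'I_n M -> option M);
  ae_rel : forall n, set (set (power 'I_n M));
  ae_op_hom : forall n (g : power 'I_n M -> M), ae_op g -> {morph g : x y / x * y};
  ae_pop_dom : forall n (h : power 'I_n M -> option M), ae_pop h -> subalgebra (pdom h);
  ae_pop_hom : forall n (h : power 'I_n M -> option M), ae_pop h -> forall x y a b,
    h x = Some a -> h y = Some b -> h (x * y) = Some (a * b);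
  ae_rel_sub : forall n (r : set (power 'I_n M)), ae_rel r -> subalgebra r }.

Section Structures.
Variables (M : ChoiceMagma.type) (MM : alter_ego M) (I : Type).

(* the tuple of i-th coordinates of an n-tuple of elements of the power M^I *)
Definition coord n (x : 'I_n -> power I M) (i : I) : power 'I_n M :=
  fun k => x k i.

(* X is (the universe of) a topologically closed substructure of MM^I. *)
Definition closed_substructure (X : set (power I M)) : Prop :=
  [/\ closed X,
      forall n g, ae_op MM g -> forall x : 'I_n -> power I M,
        (forall k, X (x k)) -> X (fun i => g (coord x i))
    & forall n h, ae_pop MM h -> forall (x : 'I_n -> power I M) y,
        (forall k, X (x k)) -> (forall i, h (coord x i) = Some (y i)) -> X y].

(* phi preserves the structure which X inherits pointwise from MM^I. *)
Definition structure_hom (X : set (power I M)) (phi : X -> M) : Prop :=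
  [/\ forall n g, ae_op MM g -> forall (x : 'I_n -> X) (y : X),
        (forall i, set_val y i = g (coord (set_val \o x) i)) ->
        phi y = g (phi \o x),
      forall n h, ae_pop MM h -> forall (x : 'I_n -> X) (y : X),
        (forall i, h (coord (set_val \o x) i) = Some (set_val y i)) ->
        h (phi \o x) = Some (phi y)
    & forall n r, ae_rel MM r -> forall x : 'I_n -> X,
        (forall i, r (coord (set_val \o x) i)) -> r (phi \o x)].

Definition E (X : set (power I M)) : set (power X M) :=
  [set phi | continuous (phi : X -> discrete_topology M) /\ structure_hom phi].

End Structures.

Arguments E {M} MM {I} X.

Section Duality.
Variables (M : ChoiceMagma.type) (MM : alter_ego M) (A : magmaType).

Definition D : set (power A M) := [set x | {morph x : a b / a * b}].

Definition evaluation (a : A) : power D M := fun x => set_val x a.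

Definition yields_duality : Prop := iso_onto (E MM D) evaluation.

Lemma continuous_proj (a : A) :
  continuous ((fun x => x a) : power A M -> discrete_topology M).
Proof.
move=> x; have /cvg_sup/(_ a) cvga : nbhs x --> x by exact: cvg_id.
apply: cvg_trans; last exact: (@initial_continuous _ (discrete_topology M)
  (fun x : power A M => x a) x).
by move=> U /cvga.
Qed.

Lemma D_closed_substructure : closed_substructure MM D.
Proof.
split.
- have -> : D = \bigcap_(p in [set: A * A])
      [set x : power A M | x (p.1 * p.2) = x p.1 * x p.2].
    by apply/seteqP; split=> [x xD [a b] _|x xD a b]; [exact: xD|exact: (xD (a, b))].
  apply: closed_bigI => -[a b] _ x /= clx.
  have nb c : nbhs x [set y : power A M | y c = x c].
    exact: (@continuous_proj c x _ (discrete_set1 (x c : discrete_topology M))).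
  have [y /= [yab [[ya yb] yc]]] :=
    clx _ (filterI (filterI (nb a) (nb b)) (nb (a * b))).
  by rewrite -yc yab ya yb.
- move=> n g gM x xD a b /=.
  rewrite -(ae_op_hom gM); congr g.
  by apply/funext => k; exact: xD.
- move=> n h hM x y xD xy a b.
  apply: Some_inj; rewrite -xy -(ae_pop_hom hM (xy a) (xy b)); congr h.
  by apply/funext => k; exact: xD.
Qed.

Lemma evaluation_hom : {morph evaluation : a b / a * b}.
Proof. by move=> a b; apply/funext => x; exact: (set_valP x). Qed.

Lemma evaluation_E (a : A) : E MM D (evaluation a).
Proof.
split; last first.
  split=> [n g _ x y|n h _ x y|n r _ x] /(_ a) //.
move=> x; exact: (continuous_comp
  (@initial_continuous D (power A M) set_val x) (@continuous_proj a _)).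
Qed.

End Duality.

Lemma E_mul (M : ChoiceMagma.type) (MM : alter_ego M) I (X : set (power I M))
  (phi psi : power X M) : E MM X phi -> E MM X psi -> E MM X (phi * psi).
Proof.
move=> [phic [phi1 phi2 phi3]] [psic [psi1 psi2 psi3]]; split; last split.
- move=> x.
  have Px : \forall y \near x, phi y = phi x :=
    phic x _ (discrete_set1 (phi x : discrete_topology M)).
  have Qx : \forall y \near x, psi y = psi x :=
    psic x _ (discrete_set1 (psi x : discrete_topology M)).
  have PQx : \forall y \near x, (phi * psi) y = (phi * psi) x.
    by apply: filterS2 Px Qx => y /= py qy; congr (_ * _).
  have Fx : Filter ((phi * psi) @ x) by apply: fmap_filter; exact: nbhs_filter.
  exact/(@discrete_cvg (discrete_topology M)).
- move=> n g gM x y xy; rewrite [LHS](congr2 mul (phi1 _ _ gM _ _ xy)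
    (psi1 _ _ gM _ _ xy)).
  by rewrite -(ae_op_hom gM).
- move=> n h hM x y xy.
  exact: (ae_pop_hom hM (phi2 _ _ hM _ _ xy) (psi2 _ _ hM _ _ xy)).
- move=> n r rM x xr.
  exact: (ae_rel_sub rM).2 (phi3 _ _ rM _ xr) (psi3 _ _ rM _ xr).
Qed.

Definition dualisable (M : ChoiceMagma.type) : Prop :=
  exists MM : alter_ego M, forall A : magmaType,
    [set: A] !=set0 -> ISP M A -> yields_duality MM A.

Definition inherently_nondualisable (M : magmaType) : Prop :=
  forall N : ChoiceMagma.type, finite_set [set: N] -> dualisable N -> ~ ISP N M.

(* Main.v *)
(* Suppose that S lies in ISP(N) with N finite. If A is in ISP(N) and z : nat -> A is *)
(* a sequence such that every homomorphism h : A -> N has only one value taken by     *)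
(* h o z more than K times, with K independent of h, then sending h to that value     *)
(* is a continuous structure-preserving map on the dual of A, whatever the alter      *)
(* ego: on any finite set of homomorphisms it agrees with evaluation at some z n.     *)
(* So no alter ego yields a duality if this map is not evaluation at an element.      *)
(*                                                                                    *)
(* For A take the algebra of ISP(S) presented by generators u(j,n), with j a          *)
(* subset of nat and n a natural number, and by the relations saying that, for n      *)
(* in j, u(j,n) u(i,n) =: z n does not depend on j and i when n is not in i, and      *)
(* u(j,n) u(j,m) =: w j does not depend on n and m when m is not in j. Given h,       *)
(* let R n be the finite set of the h(u(i,n)) with n not in i. If R b = R b' and      *)
(* R c = R c', choosing j containing b and c but neither b' nor c' gives              *)
(* h(z b) = h(w j) = h(z c); so at most one value is taken by h o z more than         *)
(* 2^|N| times.                                                                       *)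
(*                                                                                    *)
(* As HSP(S) contains a proper 3-nilpotent semigroup, no identity xy = w with w       *)
(* of length other than 2 holds in S. In particular there are a, b in S with          *)
(* ab <> (ab)^(r+1), where c^(2r+1) = c^(r+1) for all c; then a' = (ab)^r a and       *)
(* b' = b (ab)^r satisfy a'b = ab' = a'b' <> ab, so that a' and b' can play the       *)
(* role of 0. The values a, b, a', b' of the generators provide the homomorphisms     *)
(* A -> S which separate each element of A from almost all z n.                       *)

From HB Require Import structures.
Require Import Defs.
From mathcomp Require Import all_boot.
From mathcomp Require Import all_classical topology.

Set Implicit Arguments.
Unset Strict Implicit.
Unset Printing Implicit Defensive.

Local Open Scope classical_set_scope.
Local Open Scope group_scope.

(** The map without a preimage is [ghost]: by [ghost_local] it agrees on any finitely many
    homomorphisms with evaluation at a single [z i], so it preserves any structure, and [no_duality]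
    concludes. [compatible_large_fibers] bounds the fibres; [separated_by_all] and [separated_pair],
    the latter fed by [collapsing_pair], show that [ghost] is no evaluation. *)

Lemma finite_set_code (T : choiceType) :
  finite_set [set: T] -> exists k (c : T -> 'I_k), injective c.
Proof.
move=> /finite_seqP[s Ts].
have sP x : x \in s by have : [set: T] x by []; rewrite Ts.
have lt x : (index x s < size s)%N by rewrite index_mem.
exists (size s), (fun x => Ordinal (lt x)) => x y [].
exact: index_inj.
Qed.

Lemma size_sum_fibers (Q : finType) (f : nat -> Q) (s : seq nat) :
  size s = (\sum_q count (fun i => f i == q) s)%N.
Proof.
elim: s => [|i s IHs] /=; first by rewrite big1.
rewrite big_split /= -IHs (bigD1 (f i)) //= eqxx big1 ?addn0 //.
by move=> q /negPf; rewrite eq_sym => ->.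
Qed.

Lemma pigeonhole (Q : finType) (f : nat -> Q) (K n0 : nat) :
  exists s q, [/\ uniq s, (K < size s)%N
    & forall i, i \in s -> (n0 <= i)%N /\ f i = q].
Proof.
pose t := iota n0 (#|Q| * K).+1.
have [q Kq] : exists q, (K < count (fun i => f i == q) t)%N.
  apply: contrapT => /forallNP noq.
  have := size_sum_fibers f t; rewrite size_iota => tE.
  have : (\sum_q count (fun i => f i == q) t <= \sum_(q : Q) K)%N.
    by apply: leq_sum => q _; rewrite leqNgt; apply/negP; exact: noq.
  by rewrite -tE sum_nat_const ltnn.
exists [seq i <- t | f i == q], q; split.
- by rewrite filter_uniq ?iota_uniq.
- by rewrite size_filter.
- by move=> i; rewrite mem_filter mem_iota => /andP[/eqP-> /andP[]].
Qed.

(** * A limit of evaluations that belongs to every bidual *)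

Section Ghost.
Variables (N : ChoiceMagma.type) (MM : alter_ego N) (A : magmaType).
Variables (z : nat -> A) (K : nat).
Hypothesis finN : finite_set [set: N].
Hypothesis large_fibers : forall h : A -> N, {morph h : x y / x * y} ->
  forall (s t : seq nat) v w, uniq s -> uniq t ->
  (K < size s)%N -> (K < size t)%N ->
  {in s, forall i, h (z i) = v} -> {in t, forall i, h (z i) = w} -> v = w.

Lemma common_fiber (J : finType) (x : J -> @D N A) (n0 : nat) :
  exists s, [/\ uniq s, (K < size s)%N, {in s, forall i, (n0 <= i)%N}
    & {in s &, forall i i' j, set_val (x j) (z i) = set_val (x j) (z i')}].
Proof.
have [k [c c_inj]] := finite_set_code finN.
have [s [q [us Ks sq]]] :=
  pigeonhole (fun i => [ffun j => c (set_val (x j) (z i))]) K n0.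
exists s; split=> // [i /sq[]//|i i' /sq[_ qi] /sq[_ qi'] j].
by apply: c_inj; move: qi'; rewrite -qi => /ffunP/(_ j); rewrite !ffunE.
Qed.

Lemma ghost_exists (x : @D N A) : exists v, forall s,
  uniq s -> (K < size s)%N ->
  (forall w, {in s, forall i, set_val x (z i) = w} -> v = w).
Proof.
have [s [us Ks _ sx]] := common_fiber (fun _ : unit => x) 0.
have /hasP[i0 i0s _] : has predT s by rewrite has_predT (leq_ltn_trans _ Ks).
exists (set_val x (z i0)) => t ut Kt w tw.
apply: (large_fibers (set_valP x) us ut Ks Kt) tw => i si.
exact: (sx _ _ si i0s tt).
Qed.

Definition ghost (x : @D N A) : N := projT1 (cid (ghost_exists x)).

Lemma ghostE (x : @D N A) (s : seq nat) w : uniq s -> (K < size s)%N ->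
  {in s, forall i, set_val x (z i) = w} -> ghost x = w.
Proof. by move=> us Ks; rewrite /ghost; case: cid => v /= vP; exact: vP. Qed.

Lemma ghost_local (J : finType) (x : J -> @D N A) (n0 : nat) :
  exists2 i, (n0 <= i)%N & forall j, ghost (x j) = set_val (x j) (z i).
Proof.
have [s [us Ks s0 sx]] := common_fiber x n0.
have /hasP[i si _] : has predT s by rewrite has_predT (leq_ltn_trans _ Ks).
exists i => [|j]; first exact: s0.
by apply: (ghostE us Ks) => i' si'; exact: sx.
Qed.

Lemma ghost_continuous :
  continuous (ghost : @D N A -> discrete_topology N).
Proof.
move=> x; have [s [us Ks _ sx]] := common_fiber (fun _ : unit => x) 0.
have sg : {in s, forall i, set_val x (z i) = ghost x}.
  move=> i si; apply/esym/(ghostE us Ks) => i' si'; exact: (sx _ _ si' si tt).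
have near_x : \forall y \near x,
    {in s, forall i, set_val y (z i) = set_val x (z i)}.
  elim: s {us Ks sx sg} => [|i s IHs].
    by apply: (@filterE _ _ (nbhs_filter x)) => y i.
  have nbi : \forall y \near x, set_val y (z i) = set_val x (z i).
    exact: (proj1 (evaluation_E MM (z i)) x _
      (discrete_set1 (set_val x (z i) : discrete_topology N))).
  apply: (@filterS2 _ _ (nbhs_filter x)) nbi IHs => y yi ys i'.
  by rewrite inE => /predU1P[->|/ys].
have gx : \forall y \near x, ghost y = ghost x.
  by apply: (@filterS _ _ (nbhs_filter x)) near_x => y yx; apply: (ghostE us Ks) => i si;
    rewrite yx ?sg.
have Fx : Filter (ghost @ x) by apply: fmap_filter; exact: nbhs_filter.
exact/(@discrete_cvg (discrete_topology N)).
Qed.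

Lemma ghost_E : E MM (@D N A) ghost.
Proof.
split; first exact: ghost_continuous.
split=> [n g gM x y xy|n h hM x y xy|n r rM x xr].
(* [None] indexes the result [y], so that one [z i] serves the arguments and the result. *)
- have [i _ gi] := ghost_local (fun o => if o is Some k then x k else y) 0.
  rewrite (gi None) xy; congr g; apply/funext => k.
  by rewrite /= (gi (Some k)).
- have [i _ gi] := ghost_local (fun o => if o is Some k then x k else y) 0.
  rewrite (gi None) -xy; congr h; apply/funext => k.
  by rewrite /= (gi (Some k)).
- have [i _ gi] := ghost_local x 0.
  suff -> : ghost \o x = coord (set_val \o x) (z i) by exact: xr.
  by apply/funext => k; rewrite /= gi.
Qed.

Lemma no_duality :
  (forall a, exists2 h : A -> N, {morph h : x y / x * y}
    & exists n0, forall i, (n0 <= i)%N -> h a <> h (z i)) ->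
  ~ yields_duality MM A.
Proof.
move=> sepz [_ [_ _ /(_ _ ghost_E)[a _ ea]]].
have [h hM [n0 hz]] := sepz a.
pose x : @D N A := SigSub (mem_set hM : h \in @D N A).
have [i n0i /(_ tt) gi] := ghost_local (fun _ : unit => x) n0.
by apply: (hz i n0i); rewrite -[RHS]gi -ea.
Qed.

End Ghost.

(** * Two-letter identities and powers in a finite semigroup *)

Section Words.

Lemma sgprod_cat (S : semigroupType) (x y : S) s t :
  sgprod x (s ++ y :: t) = sgprod x s * sgprod y t.
Proof.
rewrite /sgprod foldl_cat /=; elim/last_ind: t => //= t w IHt.
by rewrite -cats1 !foldl_cat /= IHt mulgA.
Qed.

Lemma sgprod_power I (M : magmaType) (x : power I M) s i :
  sgprod x s i = sgprod (x i) [seq y i | y <- s].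
Proof. by rewrite /sgprod; elim: s x => //= y s IHs x; rewrite IHs. Qed.

Lemma sgprod_morph_in (M N : magmaType) (B : set M) (g : M -> N)
  (L : Type) (v : L -> M) x s :
  subalgebra B -> {in B &, {morph g : x y / x * y}} ->
  B x -> (forall l, B (v l)) ->
  B (sgprod x (map v s)) /\
  g (sgprod x (map v s)) = sgprod (g x) (map (g \o v) s).
Proof.
move=> [_ subB] gM + Bv; rewrite /sgprod.
elim: s x => //= l s IHs x Bx.
by have := IHs _ (subB _ _ Bx (Bv l)); rewrite gM ?inE.
Qed.

(** Words in two letters are coded by booleans: [true] stands for [a], [false] for [b]. *)
Definition pair_val (T : Type) (a b : T) (l : bool) : T := if l then a else b.

Lemma HSP_identity (S T : magmaType) l s : HSP S T ->
  (forall a b : S, sgprod (pair_val a b l) (map (pair_val a b) s) = a * b) ->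
  forall a b : T, sgprod (pair_val a b l) (map (pair_val a b) s) = a * b.
Proof.
move=> [J [B [g [subB gM gS]]]] idS a b.
have [x Bx <-] := gS a I; have [y By <-] := gS b I.
have BV w : B (pair_val x y w) by case: w.
have gV w : pair_val (g x) (g y) w = g (pair_val x y w) by case: w.
rewrite gV (eq_map gV) -(sgprod_morph_in s subB gM (BV l) BV).2.
rewrite -gM ?inE //; congr g; apply/funext => i.
rewrite sgprod_power -map_comp -[RHS](idS (x i) (y i)).
by rewrite (eq_map (g := pair_val (x i) (y i))); [case: (l)|case].
Qed.

Lemma nilpotent3_long (T : semigroupType) (x y1 y2 y3 : T) s :
  nilpotent 3 T -> (1 < size s)%N -> sgprod x s = y1 * y2 * y3.
Proof.
move=> nilT; case: s => // x2 [//|x3 s] _; rewrite /sgprod /=.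
elim: s x x2 x3 => /= [|x4 s IHs] x x2 x3; last exact: IHs.
exact: (nilT x y1 [:: x2; x3] [:: y2; y3]).
Qed.

(** Such an identity turns every product of two elements into a product of at least three, hence
    into a constant, and [T] would be 2-nilpotent. *)
Lemma proper_nilpotent3_identity (T : semigroupType) l s :
  proper_nilpotent 3 T -> size s <> 1%N ->
  ~ (forall a b : T, sgprod (pair_val a b l) (map (pair_val a b) s) = a * b).
Proof.
move=> [nilT nnilT] s1 idT; apply: nnilT.
suff ab (a b a' b' : T) : a * b = a' * b'.
  by move=> x y [//|x2 [|//]] [//|y2 [|//]] _ _; exact: ab.
have nil3 (x y w x' y' w' : T) : x * y * w = x' * y' * w'.
  exact: (@nilpotent3_long _ x x' y' w' [:: y; w]).
case: s s1 idT => [|l1 [//|l2 s]] _ idT.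
- case: l idT => /= idT.
    have {}idT (x y : T) : x = x * y := idT x y.
    by rewrite [LHS](idT _ a) [RHS](idT _ a); exact: nil3.
  have {}idT (x y : T) : y = x * y := idT x y.
  by rewrite [LHS](idT a) [RHS](idT a) !mulgA; exact: nil3.
- rewrite -(idT a b) -(idT a' b').
  by rewrite !(@nilpotent3_long _ _ a a a).
Qed.

(* [c ^+ n.+1]: a semigroup need not have a [c ^+ 0]. *)
Definition pow (S : semigroupType) (c : S) (n : nat) : S := sgprod c (nseq n c).

Lemma powD (S : semigroupType) (c : S) m n :
  pow c m * pow c n = pow c (m + n).+1.
Proof. by rewrite /pow -sgprod_cat -[c :: nseq n c]/(nseq n.+1 c) -nseqD addnS. Qed.

Lemma pow_period (S : semigroupType) : finite_set [set: S] ->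
  exists r, forall c : S, pow c r.+1 = pow c (r.+1 + r.+1).
Proof.
move=> /finite_set_code[k [c c_inj]].
(* [f n] codes the graph of [pow _ n]; there are finitely many graphs, so one period serves all of
   [S]. *)
pose f n : {ffun 'I_k * 'I_k -> bool} :=
  [ffun p => `[< exists x : S, c x = p.1 /\ c (pow x n) = p.2 >]].
have f_inj n m : f n = f m -> forall x : S, pow x n = pow x m.
  move=> fnm x; have : f n (c x, c (pow x n)).
    by rewrite ffunE; apply/asboolP; exists x.
  by rewrite fnm ffunE => /asboolP[y /= [/c_inj-> /c_inj]].
have [s [q [us s2 fs]]] := pigeonhole f 1 0.
have [i [d [d0 /f_inj per]]] : exists i d, (0 < d)%N /\ f i = f (i + d)%N.
  case: s us s2 fs => [|i [|i' s]] //= /andP[ii' _] _ fs.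
  have [_ fi] := fs i (mem_head _ _).
  have [_ fi'] := fs i' (@mem_behead _ [:: i, i' & s] _ (mem_head _ _)).
  have : i != i' by apply: contraNneq ii' => ->; exact: mem_head.
  rewrite neq_ltn => /orP[] lt.
    by exists i, (i' - i)%N; rewrite subn_gt0 lt subnKC ?fi ?fi' // ltnW.
  by exists i', (i - i')%N; rewrite subn_gt0 lt subnKC ?fi ?fi' // ltnW.
have perD c' m : pow c' (m + i)%N = pow c' (m + i + d)%N :> S.
  case: m => [|m]; first exact: per.
  by rewrite !addSn -addnA -!powD per.
have perM c' n e : (i <= n)%N -> pow c' n = pow c' (n + e * d)%N :> S.
  move=> lein; elim: e => [|e ->]; first by rewrite addn0.
  have -> : (n + e.+1 * d = n + e * d - i + i + d)%N.
    by rewrite subnK ?mulSn ?(leq_trans lein) ?leq_addr // -addnA (addnC d).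
  by rewrite -perD subnK // (leq_trans lein) ?leq_addr.
(* Then [r.+1] is a multiple of the period [d] and at least [i]. *)
exists ((i.+1 * d).-1) => x.
rewrite prednK ?muln_gt0 // -perM //.
by rewrite (leq_trans (leqnSn i)) // leq_pmulr.
Qed.

Lemma pow_word (S : semigroupType) (a b : S) n :
  pow (a * b) n = sgprod (pair_val a b true)
    (map (pair_val a b) (false :: flatten (nseq n [:: true; false]))).
Proof.
rewrite /pow /sgprod /=; move: {1 3}(a * b) => x.
by elim: n x => //= n IHn x; rewrite IHn mulgA.
Qed.

Lemma collapsing_pair (S : semigroupType) : finite_set [set: S] ->
  (forall s, size s <> 1%N -> exists a b : S,
     sgprod (pair_val a b true) (map (pair_val a b) s) <> a * b) ->
  exists a b a' b' : S,
    [/\ a * b' = a' * b', a' * b = a' * b' & a * b <> a' * b'].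
Proof.
move=> finS noid; have [r rP] := pow_period finS.
have [|a [b]] := noid (false :: flatten (nseq r.+1 [:: true; false])).
  by [].
rewrite -pow_word => ab.
(* As [pow] is shifted by one, [q] is the power r+1 of ab; the three products below all equal its
   power r+2. *)
pose q := pow (a * b) r.
have cq : a * (b * q) = pow (a * b) r.+1.
  by rewrite mulgA (powD (a * b) 0 r).
have qc : q * a * b = pow (a * b) r.+1.
  by rewrite -mulgA (powD (a * b) r 0) addn0.
have qcq : q * a * (b * q) = pow (a * b) r.+1.
  by rewrite mulgA qc powD rP addnS.
by exists a, b, (q * a), (b * q); rewrite cq qc qcq; split=> // /esym.
Qed.

End Words.

(** * Assignments satisfying the defining relations *)

Section Compatible.

Definition gen : Type := ((nat -> bool) * nat)%type.

(* A subset j of nat is represented by its characteristic function; u(j,n) is  *)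
(* a left factor when n is in j, and a right factor otherwise.                 *)
Definition compatible (Q : magmaType) (phi : gen -> Q) : Prop :=
  (forall n (j i j' i' : nat -> bool), j n -> ~~ i n -> j' n -> ~~ i' n ->
     phi (j, n) * phi (i, n) = phi (j', n) * phi (i', n)) /\
  (forall (j : nat -> bool) n m n' m', j n -> ~~ j m -> j n' -> ~~ j m' ->
     phi (j, n) * phi (j, m) = phi (j, n') * phi (j, m')).

Definition colprod (Q : magmaType) (phi : gen -> Q) (n : nat) : Q :=
  phi (fun=> true, n) * phi (fun=> false, n).

Definition right_values (Q : magmaType) (phi : gen -> Q) (n : nat) : set Q :=
  [set phi (j, n) | j in [set j : nat -> bool | ~~ j n]].

Lemma compatible_comp (P Q : magmaType) (h : P -> Q) (phi : gen -> P) :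
  {morph h : x y / x * y} -> compatible phi -> compatible (h \o phi).
Proof.
move=> hM [c1 c2]; split=> [n j i j' i' jn inn jn' in'|j n m n' m' jn jm jn' jm'].
  by rewrite /= -!hM (c1 n j i j' i').
by rewrite /= -!hM (c2 j n m n' m').
Qed.

(** The right factor [phi (j, b')] is also a right value at [b], so the product of row [j] is at the
    same time a product of column [b]. *)
Lemma colprod_row (Q : magmaType) (phi : gen -> Q) (j : nat -> bool) b b' :
  compatible phi -> j b -> ~~ j b' ->
  right_values phi b = right_values phi b' ->
  colprod phi b = phi (j, b) * phi (j, b').
Proof.
move=> [c1 _] jb jb' bb'.
have : right_values phi b' (phi (j, b')) by exists j.
rewrite -bb' => -[i /= ib <-].
exact: c1.
Qed.

Lemma colprod_twins (Q : magmaType) (phi : gen -> Q) b b' c c' :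
  compatible phi -> right_values phi b = right_values phi b' ->
  right_values phi c = right_values phi c' ->
  b' != b -> b' != c -> c' != b -> c' != c -> colprod phi b = colprod phi c.
Proof.
move=> cphi bb' cc' nbb nbc ncb ncc.
pose j n := (n == b) || (n == c).
have jb : j b by rewrite /j eqxx.
have jc : j c by rewrite /j eqxx orbT.
have jb' : ~~ j b' by rewrite /j negb_or nbb.
have jc' : ~~ j c' by rewrite /j negb_or ncb.
rewrite (colprod_row cphi jb jb' bb') (colprod_row cphi jc jc' cc').
exact: cphi.2.
Qed.

Lemma right_values_code (Q : magmaType) (phi : gen -> Q) k (c : Q -> 'I_k) :
  injective c -> exists f : nat -> {ffun 'I_k -> bool},
    forall n m, f n = f m -> right_values phi n = right_values phi m.
Proof.
move=> c_inj.
exists (fun n => [ffun i => `[< exists2 q, right_values phi n q & c q = i >]]).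
move=> n m /ffunP fnm; apply/seteqP; split=> q qn.
  have : `[< exists2 q', right_values phi n q' & c q' = c q >].
    by apply/asboolP; exists q.
  by move: (fnm (c q)); rewrite !ffunE => -> /asboolP[q' q'm /c_inj<-].
have : `[< exists2 q', right_values phi m q' & c q' = c q >].
  by apply/asboolP; exists q.
by move: (fnm (c q)); rewrite !ffunE => <- /asboolP[q' q'm /c_inj<-].
Qed.

Lemma exists_twins (Q : finType) (f : nat -> Q) (s : seq nat) :
  uniq s -> (#|Q| < size s)%N ->
  exists b b', [/\ b \in s, b' \in s, b' != b & f b = f b'].
Proof.
move=> us Qs; apply: contrapT => notwins.
have f_inj : {in s &, injective f}.
  move=> b b' bs b's fbb; apply: contrapT => nbb; apply: notwins.
  by exists b, b'; split=> //; apply/eqP => e; apply: nbb.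
have := max_card [in map f s].
by rewrite (card_uniqP _) ?map_inj_in_uniq // size_map leqNgt Qs.
Qed.

Lemma compatible_large_fibers (Q : magmaType) k (c : Q -> 'I_k)
  (phi : gen -> Q) (s t : seq nat) v w :
  injective c -> compatible phi -> uniq s -> uniq t ->
  (#|{: {ffun 'I_k -> bool}}| < size s)%N ->
  (#|{: {ffun 'I_k -> bool}}| < size t)%N ->
  {in s, forall i, colprod phi i = v} -> {in t, forall i, colprod phi i = w} ->
  v = w.
Proof.
move=> /right_values_code -/(_ phi)[f fP] cphi us ut Ks Kt sv tw.
have [b [b' [bs b's bb' /fP fbb]]] := exists_twins f us Ks.
have [d [d' [dt d't dd' /fP fdd]]] := exists_twins f ut Kt.
apply: contrapT => vw.
(* If [v] and [w] differ, [s] and [t] are disjoint, whence [b' != d] and [d' != b]. *)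
have st x y : x \in s -> y \in t -> x != y.
  move=> xs yt; apply/eqP => xy; apply: vw.
  by rewrite -(sv _ xs) -(tw _ yt) xy.
apply: vw; rewrite -(sv b bs) -(tw d dt).
by apply: (colprod_twins cphi fbb fdd) => //; last rewrite eq_sym; exact: st.
Qed.

End Compatible.

(** * Subalgebras of powers as members of ISP *)

Section Subalgebra.

Definition subalg (M : magmaType) (B : set M) (subB : subalgebra B) : Type :=
  set_type B.

Variables (M : magmaType) (B : set M) (subB : subalgebra B).

Definition subalg_mul (x y : subalg subB) : subalg subB :=
  SigSub (mem_set (subB.2 _ _ (set_valP x) (set_valP y))).

HB.instance Definition _ := hasMul.Build (subalg subB) subalg_mul.

Definition subalg_val (x : subalg subB) : M := set_val x.

Lemma subalg_valM : {morph subalg_val : x y / x * y}.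
Proof. by []. Qed.

Lemma subalg_val_inj : injective subalg_val.
Proof. exact: val_inj. Qed.

End Subalgebra.

Lemma ISP_embedding (N A : magmaType) : ISP N A ->
  exists I (f : A -> power I N), {morph f : x y / x * y} /\ injective f.
Proof.
move=> [I [B [f [_ [fM [_ f_inj _]]]]]]; exists I, f; split=> // x y.
by apply: f_inj; rewrite inE.
Qed.

Lemma embedding_ISP (N A : magmaType) I (f : A -> power I N) :
  [set: A] !=set0 -> {morph f : x y / x * y} -> injective f -> ISP N A.
Proof.
move=> [a0 _] fM f_inj; exists I, (range f), f; split; split=> //.
- by exists (f a0), a0.
- by move=> _ _ [x _ <-] [y _ <-]; exists (x * y).
- by split=> [x _|x y _ _ /f_inj|x]//; exists x.
Qed.

Lemma ISP_subpower (N M : magmaType) I (B : set (power I M))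
  (subB : subalgebra B) : ISP N M -> ISP N (subalg subB).
Proof.
move=> /ISP_embedding[J [f [fM f_inj]]].
have [v Bv] := subB.1.
pose F (x : subalg subB) : power (I * J) N :=
  fun p => f (subalg_val x p.1) p.2.
apply: (@embedding_ISP N (subalg subB) _ F).
- by exists (SigSub (mem_set Bv)).
- by move=> x y; apply/funext => -[i j]; rewrite /F subalg_valM fM.
- move=> x y xy; apply: subalg_val_inj; apply/funext => i; apply: f_inj.
  by apply/funext => j; exact: (congr1 (fun g => g (i, j)) xy).
Qed.

(** * The presented algebra and its separating homomorphisms *)

Section Presented.
Variable S : semigroupType.

(** Indexing a power of [S] by all compatible assignments avoids a quotient: the coordinate
    functions generate the presented algebra. *)
Definition family : Type := {phi : gen -> S | compatible phi}.

Definition words : set (power family S) :=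
  [set v | exists g s, v = fun phi => sgprod (sval phi g) (map (sval phi) s)].

Lemma words_subalgebra : subalgebra words.
Proof.
split; first by pose g : gen := (fun=> true, 0%N); eexists; exists g, [::].
move=> _ _ [g [s ->]] [g' [s' ->]]; exists g, (s ++ g' :: s').
by apply/funext => phi; rewrite map_cat sgprod_cat.
Qed.

Definition presented : magmaType := subalg words_subalgebra.

Definition generator (g : gen) : presented :=
  SigSub (mem_set (ex_intro _ g (ex_intro _ [::] erefl) :
    words (fun phi => sval phi g))).

Lemma generator_compatible : compatible generator.
Proof.
split=> [n j i j' i' jn inn jn' in'|j n m n' m' jn jm jn' jm'];
  apply: subalg_val_inj; apply/funext => -[phi [c1 c2]].
  exact: c1.
exact: c2.
Qed.

Lemma colprod_generator (n : nat) (phi : family) :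
  subalg_val (colprod generator n) phi = colprod (sval phi) n.
Proof. by []. Qed.

Section Indicator.
Variables (a b a' b' : S) (E : gen -> bool).
Hypotheses (ab' : a * b' = a' * b') (a'b : a' * b = a' * b').

Definition indicator (g : gen) : S :=
  if E g then pair_val a b (g.1 g.2) else pair_val a' b' (g.1 g.2).

Lemma indicatorM (g h : gen) : g.1 g.2 -> ~~ h.1 h.2 ->
  indicator g * indicator h = if E g && E h then a * b else a' * b'.
Proof.
by rewrite /indicator => -> /negPf->; case: (E g) (E h) => -[].
Qed.

Hypothesis E1 : forall n (j i j' i' : nat -> bool), j n -> ~~ i n -> j' n -> ~~ i' n ->
  E (j, n) && E (i, n) = E (j', n) && E (i', n).
Hypothesis E2 : forall (j : nat -> bool) n m n' m', j n -> ~~ j m -> j n' -> ~~ j m' ->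
  E (j, n) && E (j, m) = E (j, n') && E (j, m').

Lemma indicator_compatible : compatible indicator.
Proof.
split=> [n j i j' i' jn inn jn' in'|j n m n' m' jn jm jn' jm'].
  by rewrite !indicatorM // (E1 jn inn jn' in').
by rewrite !indicatorM // (E2 jn jm jn' jm').
Qed.

End Indicator.

(** The [z n] must end in one single value [d], so that one coordinate of an embedding of [S] into a
    power of [N] separates [v] from almost all of them. *)
Definition separated (v : power family S) : Prop :=
  exists (phi : family) d n0, v phi <> d /\
    forall n, (n0 <= n)%N -> colprod (sval phi) n = d.

Lemma separated_by_all (a b : S) (g : gen) (s : seq gen) :
  sgprod (pair_val a b (g.1 g.2))
    (map (pair_val a b \o (fun h => h.1 h.2)) s) <> a * b ->
  separated (fun phi => sgprod (sval phi g) (map (sval phi) s)).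
Proof.
move=> ab.
have cphi : compatible (indicator a b a b xpredT).
  exact: indicator_compatible.
by exists (exist _ _ cphi), (a * b), 0%N.
Qed.

(** It suffices that the values multiply to ab: [g] and [h] may come in the wrong order, as when [S]
    is commutative. *)
Lemma separated_pair (g h : gen) (a b a' b' : S) :
  a * b' = a' * b' -> a' * b = a' * b' -> a * b <> a' * b' ->
  pair_val a b (g.1 g.2) * pair_val a b (h.1 h.2) = a * b ->
  separated (fun phi => sval phi g * sval phi h).
Proof.
move=> ab' a'b ab gh.
have sepE (E : gen -> bool) n0 : compatible (indicator a b a' b' E) ->
    E g -> E h ->
    (forall n, (n0 <= n)%N -> ~~ (E (fun=> true, n) && E (fun=> false, n))) ->
    separated (fun phi => sval phi g * sval phi h).
  move=> cphi Eg Eh nE; exists (exist _ _ cphi), (a' * b'), n0; split=> /=.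
    by rewrite /indicator Eg Eh gh.
  by move=> n /nE /negPf nEn; rewrite /colprod indicatorM // nEn.
case: g h gh sepE => [j n] [i m] /= _ sepE.
(* The defining relations force E to contain a whole column if n = m, and a    *)
(* whole row if j = i; in the remaining case E = {g, h} respects them.         *)
have [nm|nm] := eqVneq n m.
  pose E (e : gen) := e.2 == n.
  (* Both factors of [z n] itself lie in this column, hence the bound [n.+1]. *)
  apply: (sepE E n.+1); rewrite /E ?nm ?eqxx //; last first.
    by move=> l /= lt; rewrite gtn_eqF.
  apply: indicator_compatible => //= k l l' k' p kl kl' kp kp'.
  have xor (x y : nat) : k x -> ~~ k y -> (x == m) && (y == m) = false.
    by move=> kx ky; apply/negP => /andP[/eqP xm /eqP ym]; move: ky;
      rewrite ym -xm kx.
  by rewrite !xor.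
have [ji|ji] := eqVneq j i.
  pose E (e : gen) := e.1 == j.
  have xor (k k' : nat -> bool) l : k l -> ~~ k' l -> (k == j) && (k' == j) = false.
    by move=> kl k'l; apply/negP => /andP[/eqP kj /eqP k'j]; move: k'l;
      rewrite k'j -kj kl.
  apply: (sepE E 0%N); rewrite /E ?ji ?eqxx //; last first.
    by move=> l _ /=; rewrite -ji (xor _ _ l).
  apply: indicator_compatible => //= l k p k' p' kl pl kl' pl'.
  by rewrite -ji !(xor _ _ l).
pose E (e : gen) := (e == (j, n)) || (e == (i, m)).
have E1 (k k' : nat -> bool) l : k l -> ~~ k' l -> E (k, l) && E (k', l) = false.
  move=> kl k'l; apply/negP => /andP[]; rewrite /E.
  move=> /orP[] /eqP[ek el] /orP[] /eqP[ek' el'];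
    by [move: k'l; rewrite ek' -ek kl | move: nm; rewrite -el -el' eqxx].
have E2 (k : nat -> bool) l l' : k l -> ~~ k l' -> E (k, l) && E (k, l') = false.
  move=> kl kl'; apply/negP => /andP[]; rewrite /E.
  move=> /orP[] /eqP[ek el] /orP[] /eqP[ek' el'];
    by [move: kl'; rewrite el' -el kl | move: ji; rewrite -ek -ek' eqxx].
apply: (sepE E 0%N); rewrite ?/E ?eqxx ?orbT //; last first.
  by move=> l _; rewrite -/(E _) -/(E _) (E1 _ _ l).
by apply: indicator_compatible => // *; rewrite ?E1 ?E2.
Qed.

End Presented.

Theorem theorem5p1 (S : semigroupType) (finS : finite_set [set: S])
  (nilS : exists T : semigroupType, HSP S T /\ proper_nilpotent 3 T) :
  inherently_nondualisable S.
Proof.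
have noid l s : size s <> 1%N -> exists a b : S,
    sgprod (pair_val a b l) (map (pair_val a b) s) <> a * b.
  move=> s1; apply: contrapT => noab.
  have [T [ST nilT]] := nilS.
  apply: (@proper_nilpotent3_identity T l s nilT s1).
  apply: (HSP_identity ST) => a b.
  by apply: contrapT => ab; apply: noab; exists a, b.
have sep (v : presented S) : separated (subalg_val v).
  have [g [s vE]] : words (subalg_val v) := set_valP v.
  rewrite {}vE.
  have [s1|s1] := eqVneq (size s) 1%N; last first.
    have [|a [b]] := noid (g.1 g.2) (map (fun h : gen => h.1 h.2) s).
      by rewrite size_map; exact/eqP.
    by rewrite -map_comp; exact: separated_by_all.
  case: s s1 => [//|h [|//]] _.
  have [gh|/existsNP[a /existsNP[b gh]]] := pselect (forall a b : S,
      pair_val a b (g.1 g.2) * pair_val a b (h.1 h.2) = a * b).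
    have [a [b [a' [b' [ab' a'b ab]]]]] := collapsing_pair finS (noid true).
    exact: (separated_pair ab' a'b ab).
  exact: (separated_by_all (a := a) (b := b) (s := [:: h])).
move=> N finN [MM dualN] NS.
have presN : [set: presented S] !=set0 by exists (colprod (@generator S) 0).
have [k [c c_inj]] := finite_set_code finN.
have [J [f [fM f_inj]]] := ISP_embedding NS.
apply: (@no_duality N MM (presented S) (colprod (@generator S))
  #|{: {ffun 'I_k -> bool}}| finN); last exact: dualN presN (ISP_subpower _ NS).
  move=> h hM s t v w us ut Ks Kt sv tw.
  apply: (compatible_large_fibers c_inj
    (compatible_comp hM (@generator_compatible S)) us ut Ks Kt) => i.
    by move/sv; rewrite /colprod hM.
  by move/tw; rewrite /colprod hM.
move=> v; have [phi [d [n0 [vd zd]]]] := sep v.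
have [j jP] : exists j, f (subalg_val v phi) j <> f d j.
  apply: contrapT => /forallNP fd; apply: vd; apply: f_inj; apply/funext => j.
  exact: contrapT (fd j).
exists (fun x : subalg (@words_subalgebra S) => f (subalg_val x phi) j) => [x y|].
  exact: (congr1 (@^~ j) (fM (subalg_val x phi) (subalg_val y phi))).
by exists n0 => i /zd; rewrite colprod_generator => ->.
Qed.
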